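(* Let $k\geq r\geq2$, and let $G$ be a $k$-partite $r$-graph of order $n$. For every real $p>1$, \[ \lambda^{(p)}(G)<\lambda^{(p)}(T_k^r(n)), \] unless $G=T_k^r(n)$ (up to isomorphism).
   Context: An $r$-graph of order $n$ is an $r$-uniform hypergraph with vertex set $[n]$. Its polynomial form is $P_G([x_i])=r!\sum_{\{i_1,\ldots,i_r\}\in E(G)}x_{i_1}\cdots x_{i_r}$, and for real $p\geq1$ its $p$-spectral radius is $\lambda^{(p)}(G)=\max_{|x_1|^p+\cdots+|x_n|^p=1}P_G([x_i])$. An $r$-graph is $k$-partite if its vertex set can be partitioned into $k$ sets so that each edge contains at most one vertex from each set; an edge-maximal $k$-partite $r$-graph is complete $k$-partite. $T_k^r(n)$ denotes the complete $k$-partite $r$-graph of order $n$ whose $k$ parts have sizes $\lfloor n/k\rfloor$ or $\lceil n/k\rceil$. *)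

(* Defs.v *)
From HB Require Import structures.
From mathcomp Require Import all_boot all_order all_algebra all_fingroup.
From mathcomp Require Import all_classical all_reals all_analysis.
From mathcomp Require Import zify.

Set Implicit Arguments.
Unset Strict Implicit.
Unset Printing Implicit Defensive.

Import Order.TTheory GRing.Theory Num.Theory.
Import numFieldNormedType.Exports.

Local Open Scope classical_set_scope.
Local Open Scope ring_scope.

Record uhypergraph (r n : nat) := UHypergraph {
  edges : {set {set 'I_n}};
  edges_uniform : forall e, e \in edges -> #|e| = r }.

Definition uhypergraph_iso (r n : nat) (G H : uhypergraph r n) : Prop :=
  exists s : {perm 'I_n}, edges H = [set s @: (e : {set 'I_n}) | e in edges G]%SET.

(* Partitions into k sets, empty parts allowed: for n < k the parts of
   T_k^r(n) have sizes 0 and 1. *)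
Definition kpartition (n k : nat) (V : 'I_k -> {set 'I_n}) : Prop :=
  forall i : 'I_n, exists! j : 'I_k, i \in V j.

Definition crosses (n k : nat) (V : 'I_k -> {set 'I_n}) (e : {set 'I_n}) : bool :=
  [forall j : 'I_k, (#|e :&: V j| <= 1)%N].

Definition kpartite (k r n : nat) (G : uhypergraph r n) : Prop :=
  exists V : 'I_k -> {set 'I_n},
    kpartition V /\ forall e, e \in edges G -> crosses V e.

Lemma complete_kpartite_uniform (k r n : nat) (V : 'I_k -> {set 'I_n}) e :
  e \in [set e : {set 'I_n} | (#|e| == r) && crosses V e]%SET -> #|e| = r.
Proof. by rewrite inE => /andP[/eqP]. Qed.

Definition complete_kpartite (k r n : nat) (V : 'I_k -> {set 'I_n}) : uhypergraph r n :=
  UHypergraph (@complete_kpartite_uniform k r n V).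

(* The parts are the residue classes modulo k; see card_turan_part. *)
Definition turan_part (k n : nat) (j : 'I_k) : {set 'I_n} :=
  [set i : 'I_n | (i %% k)%N == j]%SET.

Definition turan (k r n : nat) : uhypergraph r n := complete_kpartite r (@turan_part k n).

Definition polyform (R : realType) (r n : nat) (G : uhypergraph r n) (x : 'rV[R]_n) : R :=
  (r`!)%:R * \sum_(e in edges G) \prod_(i in e) x ord0 i.

Definition psphere (R : realType) (n : nat) (p : R) : set 'rV[R]_n :=
  [set x | \sum_(i < n) `|x ord0 i| `^ p = 1].

(* The maximum over the sphere, written as a supremum; it is attained for n > 0,
   see pspectral_radius_max. *)
Definition pspectral_radius (R : realType) (r n : nat) (p : R) (G : uhypergraph r n) : R :=
  sup (polyform G @` @psphere R n p).

Lemma kpartition_turan (k n : nat) : (0 < k)%N -> kpartition (@turan_part k n).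
Proof.
move=> k0 i; exists (Ordinal (ltn_pmod i k0)); split; first by rewrite inE.
by move=> j; rewrite inE => /eqP ij; apply/val_inj.
Qed.

Lemma card_turan_part (k n : nat) (j : 'I_k) :
  #|turan_part n j| = (n %/ k)%N \/ #|turan_part n j| = ((n + k.-1) %/ k)%N.
Proof.
have k0 : (0 < k)%N by apply: leq_ltn_trans (ltn_ord j).
have -> : #|turan_part n j| = ((n + (k.-1 - j)) %/ k)%N.
  rewrite -sum1_card big_mkcond /=.
  rewrite (eq_bigr (fun i : 'I_n => nat_of_bool ((i %% k)%N == j))); last first.
    by move=> i _; rewrite inE; case: eqP.
  elim: n => [|n IHn].
    by rewrite big_ord0 add0n divn_small// ; have := ltn_ord j; lia.
  rewrite big_ord_recr /= IHn addSn divnS// addnC; congr (_ + _)%N.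
  have jk := ltn_ord j.
  have -> : (n + (k.-1 - j)).+1 = (n + (k - j))%N by lia.
  congr nat_of_bool; apply/eqP/idP => [<-|].
    rewrite {1}(divn_eq n k) -addnA dvdn_addr ?dvdn_mull//.
    by rewrite subnKC// ltnW// ltn_pmod.
  have := ltn_pmod n k0.
  rewrite {2}(divn_eq n k) -addnA dvdn_addr ?dvdn_mull// => nk /dvdnP[q qE].
  case: q qE => [|[|q]] qE; lia.
have jk := ltn_ord j.
have le1 : (n %/ k <= (n + (k.-1 - j)) %/ k)%N by apply: leq_div2r; lia.
have le2 : ((n + (k.-1 - j)) %/ k <= (n + k.-1) %/ k)%N by apply: leq_div2r; lia.
have le3 : ((n + k.-1) %/ k <= (n %/ k).+1)%N.
  have -> : (n %/ k).+1 = ((n + k) %/ k)%N by rewrite divnDr// divnn k0 addn1.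
  by apply: leq_div2r; lia.
lia.
Qed.

Lemma continuous_normpow (R : realType) (p : R) : 0 < p ->
  continuous (fun x : R => `|x| `^ p).
Proof.
move=> p0 x; have [->|x0] := eqVneq x 0.
  apply/cvgrPdist_lt => e e0.
  rewrite normr0 powR0 ?gt_eqF//.
  have d0 : 0 < e `^ p^-1 by rewrite powR_gt0.
  exists (e `^ p^-1) => // y; rewrite /ball_ /= sub0r normrN => yd.
  rewrite sub0r normrN ger0_norm ?powR_ge0//.
  have -> : e = (e `^ p^-1) `^ p by rewrite -powRrM mulVf ?gt_eqF// powRr1// ltW.
  by apply: gt0_ltr_powR => //; rewrite nnegrE// powR_ge0.
apply: (@continuous_comp _ _ _ (fun x : R => `|x|) (fun y => y `^ p)).
  exact: norm_continuous.
apply/differentiable_continuous/derivable1_diffP/derivable_powR.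
by rewrite in_itv/= andbT normr_gt0.
Qed.

Lemma continuous_polyform (R : realType) (r n : nat) (G : uhypergraph r n) :
  continuous (@polyform R r n G).
Proof.
have c : continuous (fun x : 'rV[R]_n =>
    \sum_(e in edges G) \prod_(i in e) x ord0 i : R).
  apply: continuous_big => [|e _]; first exact: add_continuous.
  apply: continuous_big => [|i _]; first exact: mul_continuous.
  exact: coord_continuous.
move=> x; apply: (@continuousM R _ (cst (r`!)%:R) _ x) (c x); exact: cst_continuous.
Qed.

Lemma pspectral_radius_max (R : realType) (r n : nat) (p : R) (G : uhypergraph r n) :
  (0 < n)%N -> 1 <= p ->
  exists2 x, psphere p x &
    pspectral_radius p G = polyform G x /\
    forall y, psphere p y -> polyform G y <= polyform G x.
Proof.
move=> n0 p1.
have p0 : 0 < p by apply: lt_le_trans p1.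
have cN : continuous (fun x : 'rV[R]_n => \sum_(i < n) `|x ord0 i| `^ p).
  apply: continuous_big; first exact: add_continuous.
  move=> i _ x.
  apply: (@continuous_comp _ _ _ (fun x : 'rV[R]_n => x ord0 i)
    (fun y : R => `|y| `^ p)); first exact: coord_continuous.
  exact: continuous_normpow.
have nonempty : @psphere R n p !=set0.
  pose i0 := Ordinal n0.
  exists (\row_i (i == i0)%:R); rewrite /psphere /= (bigD1 i0)//= big1 => [|i ii0].
    by rewrite mxE eqxx normr1 powR1 addr0.
  by rewrite mxE (negbTE ii0) normr0 powR0// gt_eqF.
have cpt : compact (@psphere R n p).
  apply: bounded_closed_compact.
    exists 1; split; first exact: num_real.
    move=> M M1 x /= xS; rewrite [leLHS]/Num.norm /= mx_normrE.
    apply: bigmax_le => [|[i j] _]; first exact: ltW (lt_trans ltr01 M1).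
    rewrite /= (ord1 i); apply: le_trans (ltW M1).
    rewrite leNgt; apply/negP => x1.
    have : \sum_(i < n) `|x ord0 i| `^ p > 1.
      rewrite (bigD1 j)//= -[ltLHS]addr0; apply: ltr_leD.
        by apply: (lt_le_trans x1); apply: le1r_powR => //; exact: ltW.
      by apply: sumr_ge0 => l _; exact: powR_ge0.
    by rewrite xS ltxx.
  rewrite (_ : psphere p = (fun x => \sum_(i < n) `|x ord0 i| `^ p) @^-1` [set 1])//.
  by apply: preimage_closed => [x _|]; [exact: cN|exact: closed_eq].
have [x /set_mem xS xmax] := compact_EVT_max nonempty cpt
  (continuous_subspaceT (@continuous_polyform R r n G)).
have xmax' y : psphere p y -> polyform G y <= polyform G x.
  by move=> yS; apply: xmax; exact: mem_set.
exists x => //; split=> //; apply/eqP; rewrite eq_le; apply/andP; split.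
  apply: ge_sup; first by exists (polyform G x), x.
  by move=> _ [y yS <-]; exact: xmax'.
apply: ub_le_sup; last by exists x.
by exists (polyform G x) => _ [y yS <-]; exact: xmax'.
Qed.

(* Main.v *)
Require Import Defs.
From mathcomp Require Import all_classical all_reals all_analysis.
From mathcomp Require Import all_boot all_order all_algebra all_fingroup.
From mathcomp Require Import zify ring.

(** For a colouring [c] with colour sums [s_1, ..., s_k], the polynomial form of
    the complete multipartite graph of [c] is [r!] times the elementary symmetric
    polynomial [e_r(s_1, ..., s_k)], which is [A + B (s_a + s_b) + C s_a s_b] in
    any two of its variables.  Suppose that the class [a] has at least two
    vertices more than the class [b], and put [theta = 1 / (n_a - n_b)].
    Replacing the two classes by their mixtures in the proportions
    [1 - theta : theta] and [theta : 1 - theta] moves one vertex from [a] to [b],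
    keeps [s_a + s_b], multiplies [s_a - s_b] by a factor in [0, 1), and does not
    increase the [p]-norm by convexity of [y |-> y^p]; since [p > 1], the last
    step is strict when [s_a = s_b > 0].  So a colouring of largest radius is
    balanced, and its graph is the Turan graph.  A maximizer of a complete
    multipartite graph has positive entries, so a proper subgraph has a strictly
    smaller radius. *)

Set Implicit Arguments.
Unset Strict Implicit.
Unset Printing Implicit Defensive.

Import Order.TTheory GRing.Theory Num.Theory.
Import numFieldNormedType.Exports.

Local Open Scope ring_scope.

Section Rainbow.
Context {R : comNzRingType} {T C : finType}.
Implicit Types (c : T -> C) (m : nat) (D : {set C}) (e : {set T}) (x : T -> R).

Definition rainbow c m D e : bool :=
  [&& #|e| == m, #|c @: e| == m & c @: e \subset D].

Definition rainbow_sum c m D x : R :=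
  \sum_(e : {set T} | rainbow c m D e) \prod_(i in e) x i.

Definition fibre c (j : C) : {set T} := [set i | c i == j]%SET.

Definition colour_sum c x (j : C) : R := \sum_(i in fibre c j) x i.

Lemma card_rainbow_fibre c m D e j : rainbow c m D e ->
  #|fibre c j :&: e| = (j \in c @: e).
Proof.
case/and3P=> /eqP em /eqP cm _.
have c_inj : {in e &, injective c} by apply/imset_injP; rewrite em cm.
have [/imsetP[i ie ->]|jN] := boolP (j \in _).
  apply/eqP/cards1P; exists i; apply/setP => i'; rewrite !inE.
  by apply/andP/eqP => [[/eqP ci i'e]|->//]; exact: c_inj.
apply: eq_card0 => i; rewrite !inE; apply: contraNF jN => /andP[/eqP <- ie].
exact: imset_f.
Qed.

Lemma rainbow_setU1 c m D e i : c i \notin D -> i \notin e ->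
  rainbow c m.+1 (c i |: D)%SET (i |: e)%SET = rainbow c m D e.
Proof.
move=> ciD ie; rewrite /rainbow imsetU1 !cardsU1 ie eqSS.
have [em|//] := eqVneq #|e| m; rewrite /= subUset sub1set setU11 /=.
have [cie|cie] := boolP (c i \in c @: e).
  rewrite [_ \subset D](contraNF _ ciD) ?andbF; last by move/subsetP; exact.
  by rewrite add0n ltn_eqF// ltnS -em leq_imset_card.
by rewrite eqSS -[in RHS](setU1K ciD) subsetD1 cie andbT.
Qed.

Lemma rainbow_sum_mem c m D x i : c i \notin D ->
  \sum_(e | rainbow c m.+1 (c i |: D)%SET e && (i \in e)) \prod_(l in e) x l =
  x i * rainbow_sum c m D x.
Proof.
move=> ciD; rewrite mulr_sumr.
rewrite (reindex_onto (fun e => i |: e)%SET (fun e => e :\ i)%SET) /=; last first.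
  by move=> e /andP[_ ie]; rewrite setD1K.
have notin e : rainbow c m D e -> i \notin e.
  move=> /and3P[_ _ /subsetP eD]; apply: contra ciD => ie.
  by apply: eD; exact: imset_f.
apply: eq_big => [e|e /andP[_ /eqP ie]]; last first.
  by rewrite big_setU1// -ie !inE eqxx.
rewrite setU11 andbT; apply/andP/idP => [[re /eqP ie]|re].
  by rewrite -(rainbow_setU1 m ciD)// -ie !inE eqxx.
by rewrite rainbow_setU1 ?setU1K ?notin ?eqxx.
Qed.

Lemma rainbow_sum_setU1 c m D x j : j \notin D ->
  rainbow_sum c m.+1 (j |: D)%SET x =
  rainbow_sum c m.+1 D x + colour_sum c x j * rainbow_sum c m D x.
Proof.
move=> jD; rewrite {1}/rainbow_sum (bigID (fun e : {set T} => j \in c @: e)) /= addrC.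
congr (_ + _).
  apply: eq_bigl => e; rewrite -!andbA; do 2!congr (_ && _).
  by rewrite -subsetD1 setU1K.
rewrite /colour_sum mulr_suml.
under [RHS]eq_bigr => i do
  [rewrite inE => /eqP ci; rewrite -rainbow_sum_mem ci//].
rewrite (exchange_big_dep (rainbow c m.+1 (j |: D)%SET)) => [|i e _ /andP[]//].
rewrite big_mkcondr; apply: eq_bigr => e re.
rewrite [RHS](eq_bigl [in (fibre c j :&: e)%SET]) => [|i]; last by rewrite !inE re.
rewrite sumr_const (card_rainbow_fibre j re).
by case: (j \in _).
Qed.

Lemma rainbow_sum0 c D x : rainbow_sum c 0 D x = 1.
Proof.
rewrite /rainbow_sum (big_pred1 set0) ?big_set0// => e.
rewrite /rainbow cards_eq0 /=; have [->|//] := eqVneq e set0.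
by rewrite imset0 cards0 sub0set !eqxx.
Qed.

Lemma rainbow_sum_set0 c m x : rainbow_sum c m.+1 set0 x = 0.
Proof.
apply: big1 => e /and3P[_ /eqP cm]; rewrite subset0 => /eqP ce.
by rewrite ce cards0 in cm.
Qed.

End Rainbow.

Section ElementarySymmetric.
Context {R : comNzRingType} {C : finType}.
Implicit Types (m : nat) (D : {set C}) (s t : C -> R).

Definition elem_sym m D s : R :=
  \sum_(J : {set C} | (J \subset D) && (#|J| == m)) \prod_(j in J) s j.

Lemma elem_symE m D s : elem_sym m D s = rainbow_sum id m D s.
Proof.
by apply: eq_bigl => J; rewrite /rainbow imset_id andbC; case: eqP.
Qed.

Lemma eq_elem_sym m D s t : {in D, s =1 t} -> elem_sym m D s = elem_sym m D t.
Proof.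
move=> st; apply: eq_bigr => J /andP[/subsetP JD _].
by apply: eq_bigr => j /JD; exact: st.
Qed.

Lemma elem_sym_setU1 m D s j : j \notin D ->
  elem_sym m.+1 (j |: D)%SET s = elem_sym m.+1 D s + s j * elem_sym m D s.
Proof.
move=> jD; rewrite !elem_symE rainbow_sum_setU1//; congr (_ + _ * _).
by rewrite /colour_sum (big_pred1 j)// => i; rewrite inE.
Qed.

Lemma rainbow_sumE {T : finType} (c : T -> C) m D (x : T -> R) :
  rainbow_sum c m D x = elem_sym m D (colour_sum c x).
Proof.
elim: {D}_.+1 {-2}D (ltnSn #|D|) m => // N IHN D DN [|m].
  by rewrite elem_symE !rainbow_sum0.
have [->|[j jD]] := set_0Vmem D; first by rewrite elem_symE !rainbow_sum_set0.
have jDj : j \notin (D :\ j)%SET by rewrite !inE eqxx.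
rewrite -(setD1K jD) rainbow_sum_setU1// elem_sym_setU1//.
by rewrite !IHN//; rewrite (cardsD1 j D) jD in DN.
Qed.

Lemma elem_sym_transfer m s t a b : a != b ->
  {in (~: [set a; b])%SET, s =1 t} -> s a + s b = t a + t b ->
  elem_sym m.+2 setT t - elem_sym m.+2 setT s =
  (t a * t b - s a * s b) * elem_sym m (~: [set a; b])%SET s.
Proof.
set D := (~: [set a; b])%SET => ab st sum_eq.
have bD : b \notin D by rewrite !inE eqxx orbT.
have abD : a \notin (b |: D)%SET by rewrite !inE eqxx (negbTE ab).
have -> : [set: C] = (a |: (b |: D))%SET.
  by apply/setP => i; rewrite !inE; do 2?case: eqP.
rewrite !elem_sym_setU1// -!(eq_elem_sym _ st).
by have -> : t a = s a + s b - t b; [rewrite sum_eq addrK|ring].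
Qed.

End ElementarySymmetric.

Section ElementarySymmetricOrder.
Context {R : realDomainType} {C : finType}.
Implicit Types (m : nat) (D : {set C}) (s t : C -> R).

Lemma elem_sym_ge0 m D s : (forall j, 0 <= s j) -> 0 <= elem_sym m D s.
Proof. by move=> s0; apply: sumr_ge0 => J _; exact: prodr_ge0. Qed.

Lemma elem_sym_gt0 m D s : (forall j, 0 <= s j) ->
  (0 < elem_sym m D s) = (m <= #|[set j in D | (0 < s j)%R]|)%N.
Proof.
move=> s0; rewrite lt0r elem_sym_ge0// andbT psumr_neq0 => [|J _]; last exact: prodr_ge0.
apply/hasP/idP => [[J _ /andP[/andP[/subsetP JD /eqP <-]]]|].
  rewrite lt0r => /andP[/prodf_neq0 sJ _].
  apply/subset_leq_card/subsetP => j jJ.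
  by rewrite inE JD// lt0r s0 sJ.
move=> /card_geqP[l [l_uniq <- lD]]; exists [set j in l]%SET; first exact: mem_index_enum.
rewrite cardsE (card_uniqP l_uniq) eqxx andbT; apply/andP; split.
  by apply/subsetP => j; rewrite inE => /lD; rewrite inE => /andP[].
by apply: prodr_gt0 => j; rewrite inE => /lD; rewrite inE => /andP[].
Qed.

Section Transfer.
Variables (m : nat) (s t : C -> R) (a b : C).
Hypotheses (m_gt1 : (1 < m)%N) (s_ge0 : forall j, 0 <= s j) (ab : a != b).
Hypotheses (st : {in (~: [set a; b])%SET, s =1 t}) (sum_eq : s a + s b = t a + t b).

Lemma elem_sym_le_transfer : s a * s b <= t a * t b ->
  elem_sym m setT s <= elem_sym m setT t.
Proof.
move: m m_gt1 => [|[|l]]// _ prod_le.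
by rewrite -subr_ge0 (elem_sym_transfer _ ab)// mulr_ge0 ?subr_ge0 ?elem_sym_ge0.
Qed.

Lemma elem_sym_lt_transfer : 0 < elem_sym m setT s -> s a * s b < t a * t b ->
  elem_sym m setT s < elem_sym m setT t.
Proof.
move: m m_gt1 => [|[|l]]// _; rewrite elem_sym_gt0// => m_le_pos prod_lt.
rewrite -subr_gt0 (elem_sym_transfer _ ab)// mulr_gt0 ?subr_gt0// elem_sym_gt0//.
set P := [set j in _ | _]%SET in m_le_pos; have := cardsD P [set a; b]%SET.
have := subset_leq_card (subsetIr P [set a; b]%SET).
rewrite cards2 ab; have -> : (P :\: [set a; b] = [set j in ~: [set a; b] | 0 < s j])%SET.
  by apply/setP => j; rewrite !inE.
by move=> cap_le2 cardP; lia.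
Qed.

End Transfer.
End ElementarySymmetricOrder.

Section PowerConvexity.
Context {R : realType} {p : R}.
Hypothesis p_gt1 : 1 < p.

Let p_gt0 : 0 < p. Proof. exact: lt_trans p_gt1. Qed.

Lemma powR_MVT (a b : R) : 0 <= a -> a < b ->
  exists2 t, t \in `]a, b[ & b `^ p - a `^ p = p * t `^ (p - 1) * (b - a).
Proof.
move=> a_ge0 ab.
apply: (@MVT R (fun t => t `^ p) (fun t => p * t `^ (p - 1)) _ _ ab) => [t|].
  by rewrite in_itv /= => /andP[at_ _]; apply: is_derive1_powR; exact: le_lt_trans at_.
apply: (@subspace_eq_continuous _ `[a, b]%classic _ (fun t : R => `|t| `^ p)).
  by move=> t /set_mem/=; rewrite in_itv /= => /andP[/(le_trans a_ge0)/ger0_norm ->].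
exact/continuous_subspaceT/continuous_normpow.
Qed.

Lemma leif_powR_tangent (w y : R) : 0 <= w -> 0 <= y ->
  w `^ p + p * w `^ (p - 1) * (y - w) <= y `^ p ?= iff (y == w).
Proof.
move=> w_ge0 y_ge0; apply/leifP.
have incr (s t : R) : 0 <= s -> s < t -> s `^ (p - 1) < t `^ (p - 1).
  move=> s_ge0 st; apply: gt0_ltr_powR; rewrite ?nnegrE ?subr_gt0//.
  exact: le_trans (ltW st).
have [yw|wy|->] := ltgtP y w; last by rewrite subrr mulr0 addr0.
  have [t /itvP tyw secantE] := powR_MVT y_ge0 yw.
  rewrite -ltrBrDl -[y - w]opprB -[_ - w `^ p]opprB secantE mulrN ltrN2.
  by rewrite -!mulrA ltr_pM2l// ltr_pM2r ?subr_gt0// incr ?(le_trans y_ge0) ?tyw.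
have [t /itvP twy secantE] := powR_MVT w_ge0 wy.
rewrite -ltrBrDl secantE -!mulrA ltr_pM2l// ltr_pM2r ?subr_gt0//.
by rewrite incr ?twy.
Qed.

Lemma lt_double_powR (h : R) : 0 < h -> h `^ p + h `^ p < (h + h) `^ p.
Proof.
move=> h_gt0; have h_ge0 := ltW h_gt0.
apply: lt_le_trans (leif_powR_tangent h_ge0 (addr_ge0 h_ge0 h_ge0)).1.
rewrite addrK -mulrA [_ * h]mulrC mulr_powRB1// ltrD2l ltr_pMl//.
exact: powR_gt0.
Qed.

(* Summing the tangent inequalities at the mean, the linear terms cancel. *)
Lemma leif_powR_mean (I : finType) (D : {set I}) (mu x : I -> R) (mean : R) :
  {in D, forall i, 0 < mu i} -> {in D, forall i, 0 <= x i} -> 0 <= mean ->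
  (\sum_(i in D) mu i) * mean = \sum_(i in D) mu i * x i ->
  (\sum_(i in D) mu i) * mean `^ p <= \sum_(i in D) mu i * x i `^ p
    ?= iff [forall i in D, x i == mean].
Proof.
move=> mu_gt0 x_ge0 mean_ge0 meanE.
have -> : (\sum_(i in D) mu i) * mean `^ p =
    \sum_(i in D) mu i * (mean `^ p + p * mean `^ (p - 1) * (x i - mean)).
  under [RHS]eq_bigr do rewrite mulrDr mulrCA mulrBr.
  by rewrite big_split /= -mulr_suml -mulr_sumr sumrB -mulr_suml meanE subrr mulr0 addr0.
apply: leif_sum => i iD; rewrite (mono_leif (ler_pM2l (mu_gt0 i iD))).
by apply: leif_powR_tangent => //; exact: x_ge0.
Qed.

End PowerConvexity.

Lemma mixing_proportion (R : realFieldType) (m n : nat) : (n.+1 < m)%N ->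
  exists theta : R, [/\ 0 < theta, 0 < 1 - theta,
    (1 - theta) * m%:R + theta * n%:R = m.-1%:R &
    theta * m%:R + (1 - theta) * n%:R = n.+1%:R].
Proof.
move=> nm; have gap : 1 < m%:R - n%:R :> R by rewrite ltrBrDl natr1 ltr_nat.
have gap_gt0 : 0 < m%:R - n%:R :> R by exact: lt_trans gap.
exists (m%:R - n%:R)^-1; split; first by rewrite invr_gt0.
- by rewrite subr_gt0 invf_lt1.
- by rewrite -subn1 natrB; [field; rewrite gt_eqF|lia].
- by rewrite -natr1; field; rewrite gt_eqF.
Qed.

Lemma leif_mul_mix (R : realDomainType) (s t theta : R) : 0 < theta -> 0 < 1 - theta ->
  s * t <= ((1 - theta) * s + theta * t) * (theta * s + (1 - theta) * t) ?= iff (s == t).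
Proof.
move=> theta_gt0 theta_lt1; apply/leifP.
have diffE : ((1 - theta) * s + theta * t) * (theta * s + (1 - theta) * t) - s * t =
  theta * (1 - theta) * (s - t) ^+ 2 by ring.
have [->|st] := eqVneq s t; first by apply/eqP; ring.
by rewrite -subr_gt0 diffE mulr_gt0 ?exprn_even_gt0 ?subr_eq0//; exact: mulr_gt0.
Qed.

Section Rebalancing.
Context {R : realType} {I : finType}.
Variables (A B : {set I}) (p : R) (x : I -> R).
Hypotheses (p_gt1 : 1 < p) (x_gt0 : forall i, 0 < x i) (AB_disjoint : [disjoint A & B]).

Lemma sum_blocks (a b : R) (F : I -> R) :
  \sum_(i in (A :|: B)%SET) (if i \in A then a else b) * F i =
  a * (\sum_(i in A) F i) + b * (\sum_(i in B) F i).
Proof.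
rewrite (eq_bigl [predU A & B]) => [|i]; last by rewrite !inE.
rewrite bigU//= !mulr_sumr; congr (_ + _); apply: eq_bigr => i iAB; rewrite ?iAB//.
by rewrite (disjointFl AB_disjoint).
Qed.

Lemma leif_powR_block_mean (a b : R) (M := a * #|A|%:R + b * #|B|%:R) :
  0 < a -> 0 < b -> (0 < #|A|)%N ->
  exists mean : R, [/\ 0 <= mean,
    M * mean = a * (\sum_(i in A) x i) + b * (\sum_(i in B) x i) &
    M * mean `^ p <= a * (\sum_(i in A) x i `^ p) + b * (\sum_(i in B) x i `^ p)
      ?= iff [forall i in (A :|: B)%SET, x i == mean]].
Proof.
move=> a_gt0 b_gt0 A_gt0.
have M_gt0 : 0 < M by rewrite ltr_wpDr ?mulr_ge0 ?ler0n ?(ltW b_gt0)// mulr_gt0 ?ltr0n.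
pose mean := (a * (\sum_(i in A) x i) + b * (\sum_(i in B) x i)) / M.
have mean_ge0 : 0 <= mean.
  have sum_ge0 (D : {set I}) : 0 <= \sum_(i in D) x i.
    by apply: sumr_ge0 => i _; exact: ltW.
  by rewrite divr_ge0 ?(ltW M_gt0)// addr_ge0// mulr_ge0// ltW.
have meanE : M * mean = a * (\sum_(i in A) x i) + b * (\sum_(i in B) x i).
  by rewrite mulrC divfK ?gt_eqF.
exists mean; split=> //; move: meanE; rewrite /M -!sum1_card !natr_sum -!sum_blocks.
under eq_bigr do rewrite mulr1.
by apply: leif_powR_mean => // i _; [case: ifP|exact: ltW].
Qed.

Lemma sum_const_block (v : R) : (forall i, i \in (A :|: B)%SET -> x i = v) ->
  \sum_(i in A) x i = #|A|%:R * v /\ \sum_(i in B) x i = #|B|%:R * v.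
Proof.
move=> xv; rewrite !mulr_natl -!sumr_const; split; apply: eq_bigr => i iAB.
  by rewrite xv// inE iAB.
by rewrite xv// inE iAB orbT.
Qed.

(* [v] and [w] are the means of the two mixtures of [A] and [B], whose masses are
   [#|A| - 1] and [#|B| + 1]. *)
Lemma rebalance_blocks (sA := \sum_(i in A) x i) (sB := \sum_(i in B) x i)
    (N := \sum_(i in A) x i `^ p + \sum_(i in B) x i `^ p) :
  (#|B|.+1 < #|A|)%N ->
  exists v w : R, let sA' := #|A|.-1%:R * v in let sB' := #|B|.+1%:R * w in
  let N' := #|A|.-1%:R * v `^ p + #|B|.+1%:R * w `^ p in
  [/\ 0 <= v /\ 0 <= w, sA + sB = sA' + sB', sA * sB <= sA' * sB', N' <= N &
      sA * sB < sA' * sB' \/ N' < N].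
Proof.
move=> cardBA.
have [theta [theta_gt0 theta_lt1 massA massB]] := mixing_proportion R cardBA.
have A_gt0 : (0 < #|A|)%N by lia.
have [v [v_ge0 vE normA]] := leif_powR_block_mean theta_lt1 theta_gt0 A_gt0.
have [w [w_ge0 wE normB]] := leif_powR_block_mean theta_gt0 theta_lt1 A_gt0.
rewrite massA in vE normA; rewrite massB in wE normB.
have := leifD normA normB.
rewrite addrACA -!mulrDl [theta + _]addrC !subrK !mul1r => normAB.
have := leif_mul_mix sA sB theta_gt0 theta_lt1; rewrite -vE -wE => prodAB.
exists v, w; split=> //; [|exact: prodAB.1|exact: normAB.1|].
  by rewrite vE wE addrACA -!mulrDl [theta + _]addrC !subrK !mul1r.
have [sAB|sAB] := eqVneq sA sB; last by left; rewrite (lt_leif prodAB).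
right; rewrite (lt_leif normAB) negb_and; apply/orP; left.
apply: contra_eqN sAB => /forall_inP xv.
have /card_gt0P[i iA] := A_gt0.
have v_gt0 : 0 < v by rewrite -(eqP (xv i _)) ?inE ?iA.
have [sAE sBE] := sum_const_block (fun i iAB => eqP (xv i iAB)).
rewrite /sA /sB sAE sBE (inj_eq (mulIf (lt0r_neq0 v_gt0))) eqr_nat gtn_eqF//; lia.
Qed.

End Rebalancing.

Section PowerSum.
Context {R : realType} {n : nat}.
Implicit Types (p a : R) (x : 'rV[R]_n).

Definition power_sum p x : R := \sum_(i < n) `|x ord0 i| `^ p.

Lemma power_sum_ge0 p x : 0 <= power_sum p x.
Proof. by apply: sumr_ge0 => i _; exact: powR_ge0. Qed.

Lemma power_sum_eq0 p x : 0 < p -> (power_sum p x == 0) = (x == 0).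
Proof.
move=> p_gt0; apply/eqP/eqP => [|->]; last first.
  by apply: big1 => i _; rewrite mxE normr0 powR0 ?gt_eqF.
move=> /psumr_eq0P x0; apply/rowP => i; apply/eqP; rewrite mxE -normr_eq0.
by apply/eqP/(@powR_eq0_eq0 _ _ p)/x0 => // j _; exact: powR_ge0.
Qed.

Lemma power_sumZ p a x : power_sum p (a *: x) = `|a| `^ p * power_sum p x.
Proof.
by rewrite /power_sum mulr_sumr; apply: eq_bigr => i _; rewrite mxE normrM powRM.
Qed.

End PowerSum.

Section Radius.
Context {R : realType} {r n : nat}.
Implicit Types (G H : uhypergraph r n) (p a : R) (x y : 'rV[R]_n).

Lemma polyformZ G a x : polyform G (a *: x) = a ^+ r * polyform G x.
Proof.
rewrite /polyform mulrCA; congr (_ * _); rewrite mulr_sumr; apply: eq_bigr => e eG.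
under eq_bigr do rewrite mxE.
by rewrite big_split /= prodr_const (edges_uniform eG).
Qed.

Lemma polyform_le_radius G p y : (0 < r)%N -> 1 <= p ->
  polyform G y <= pspectral_radius p G * power_sum p y `^ (r%:R / p).
Proof.
move=> r_gt0 p_ge1; have p_gt0 : 0 < p by exact: lt_le_trans p_ge1.
have [->|y_neq0] := eqVneq y 0.
  have -> : power_sum p (0 : 'rV[R]_n) = 0 by apply/eqP; rewrite power_sum_eq0.
  rewrite powR0 ?mulr0; last by rewrite mulf_neq0 ?invr_neq0 ?gt_eqF ?ltr0n.
  by rewrite -(scale0r y) polyformZ expr0n gtn_eqF// mul0r.
have /rV0Pn[i _] := y_neq0; have n_gt0 := leq_ltn_trans (leq0n i) (ltn_ord i).
have N_gt0 : 0 < power_sum p y by rewrite lt0r power_sum_eq0// y_neq0 power_sum_ge0.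
pose b := power_sum p y `^ p^-1; have b_gt0 : 0 < b by rewrite powR_gt0.
have b_pow : b `^ p = power_sum p y by rewrite -powRrM mulVf ?gt_eqF// powRr1 ?ltW.
have sphere_y : psphere p (b^-1 *: y).
  rewrite /psphere /= -/(power_sum p (b^-1 *: y)) power_sumZ gtr0_norm ?invr_gt0//.
  rewrite -powR_inv1 ?(ltW b_gt0)// powRAC b_pow powR_inv1 ?(ltW N_gt0)//.
  by rewrite mulVf ?gt_eqF.
have [x _ [-> /(_ _ sphere_y)]] := pspectral_radius_max G n_gt0 p_ge1.
have -> : power_sum p y `^ (r%:R / p) = b ^+ r.
  by rewrite mulrC powRrM powR_mulrn// ltW.
by rewrite polyformZ exprVn ler_pdivrMl ?exprn_gt0// mulrC.
Qed.

Lemma radius_gt0 G p y : (0 < r)%N -> 1 <= p -> 0 < polyform G y ->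
  0 < pspectral_radius p G.
Proof.
move=> r_gt0 p_ge1 /lt_le_trans/(_ (polyform_le_radius G y r_gt0 p_ge1)).
by rewrite !ltNge; apply: contra => radius_le0; rewrite mulr_le0_ge0 ?powR_ge0.
Qed.

Lemma lt_radius G p y c : (0 < r)%N -> 1 <= p -> 0 < c -> c <= polyform G y ->
  power_sum p y <= 1 -> c < polyform G y \/ power_sum p y < 1 ->
  c < pspectral_radius p G.
Proof.
move=> r_gt0 p_ge1 c_gt0 cG N_le1 strict.
have p_gt0 : 0 < p by exact: lt_le_trans p_ge1.
have Gy_le := polyform_le_radius G y r_gt0 p_ge1.
have rp_gt0 : 0 < r%:R / p by rewrite divr_gt0 ?ltr0n.
have G_gt0 := radius_gt0 r_gt0 p_ge1 (lt_le_trans c_gt0 cG).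
have [N_lt1|] := ltP (power_sum p y) 1.
  apply: le_lt_trans (le_trans cG Gy_le) _; rewrite gtr_pMr//.
  have := gt0_ltr_powR rp_gt0 _ _ N_lt1; rewrite powR1; apply; rewrite ?nnegrE//.
  exact: power_sum_ge0.
case: strict => [cGy N_ge1|/lt_geF->//]; apply: lt_le_trans cGy _.
by rewrite (le_trans Gy_le)// (@le_anti _ _ (power_sum p y) 1) ?N_le1// powR1 mulr1.
Qed.

Lemma radius_gt0_edges G p : edges G != set0 -> (0 < r)%N -> 1 <= p ->
  0 < pspectral_radius p G.
Proof.
move=> /set0Pn[e eG] r_gt0 p_ge1; apply: (radius_gt0 (y := const_mx 1)) => //.
rewrite mulr_gt0 ?ltr0n ?fact_gt0// (bigD1 e)//= ltr_wpDr//.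
  by apply: sumr_ge0 => e' _; apply: prodr_ge0 => i _; rewrite mxE.
by apply: prodr_gt0 => i _; rewrite mxE.
Qed.

Lemma nonneg_maximizer G p : (0 < n)%N -> 1 <= p -> exists x : 'rV[R]_n,
  [/\ forall i, 0 <= x ord0 i, power_sum p x = 1 & polyform G x = pspectral_radius p G].
Proof.
move=> n_gt0 p_ge1.
have [x x_sphere [-> xmax]] := pspectral_radius_max G n_gt0 p_ge1.
pose y := \row_i `|x ord0 i| : 'rV[R]_n.
have y_sphere : power_sum p y = 1.
  by rewrite -[RHS]x_sphere; apply: eq_bigr => i _; rewrite mxE normr_id.
exists y; split=> [i|//|]; first by rewrite mxE.
apply/le_anti; rewrite xmax//= ler_wpM2l//; apply: ler_sum => e _.
apply: le_trans (ler_norm _) _; rewrite normr_prod.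
by under [leRHS]eq_bigr do rewrite mxE.
Qed.

Lemma polyform_subgraph G H x : edges G \subset edges H ->
  polyform H x = polyform G x +
    (r`!)%:R * \sum_(e in edges H :\: edges G) \prod_(i in e) x ord0 i.
Proof.
move=> GH; rewrite /polyform -mulrDr; congr (_ * _).
by rewrite (big_setID (edges G)) /= (setIidPr GH).
Qed.

Lemma polyform_subset G H x : edges G \subset edges H -> (forall i, 0 <= x ord0 i) ->
  polyform G x <= polyform H x.
Proof.
move=> GH x_ge0; rewrite (polyform_subgraph x GH) lerDl mulr_ge0// sumr_ge0// => e _.
exact: prodr_ge0.
Qed.

Lemma polyform_proper G H x : edges G \proper edges H -> (forall i, 0 < x ord0 i) ->
  polyform G x < polyform H x.
Proof.
move=> /properP[GH [e eH eG]] x_gt0; rewrite (polyform_subgraph x GH) ltrDl.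
rewrite mulr_gt0 ?ltr0n ?fact_gt0// (bigD1 e) ?inE ?eG//= ltr_wpDr ?prodr_gt0//.
by apply: sumr_ge0 => e' _; apply: prodr_ge0 => i _; exact: ltW.
Qed.

Lemma radius_subset G H p : (0 < n)%N -> 1 <= p -> edges G \subset edges H ->
  pspectral_radius p G <= pspectral_radius p H.
Proof.
move=> n_gt0 p_ge1 GH; have [x [x_ge0 x_sphere <-]] := nonneg_maximizer G n_gt0 p_ge1.
have [y _ [-> ymax]] := pspectral_radius_max H n_gt0 p_ge1.
exact: le_trans (polyform_subset GH x_ge0) (ymax _ x_sphere).
Qed.

Lemma polyform_perm G H (s : {perm 'I_n}) x :
  edges H = [set s @: (e : {set 'I_n}) | e in edges G]%SET ->
  polyform H x = polyform G (\row_i x ord0 (s i)).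
Proof.
move=> HE; rewrite /polyform HE big_imset /=; last first.
  by move=> e e' _ _; apply/imset_inj/perm_inj.
congr (_ * _); apply: eq_bigr => e _; rewrite big_imset /=; last first.
  by move=> i j _ _; exact: perm_inj.
by apply: eq_bigr => i _; rewrite mxE.
Qed.

Lemma psphere_perm p (s : {perm 'I_n}) x : psphere p x -> psphere p (\row_i x ord0 (s i)).
Proof.
rewrite /psphere /= => <-; rewrite [RHS](reindex_inj (@perm_inj _ s)).
by apply: eq_bigr => i _; rewrite mxE.
Qed.

Lemma radius_iso G H p : uhypergraph_iso G H ->
  pspectral_radius p G = pspectral_radius p H.
Proof.
case=> s HE; congr sup; apply/seteqP; split=> _ [x x_sphere <-]; last first.
  by exists (\row_i x ord0 (s i)); [exact: psphere_perm|rewrite (polyform_perm _ HE)].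
exists (\row_i x ord0 ((s^-1)%g i)); first exact: psphere_perm.
by rewrite (polyform_perm _ HE); congr polyform; apply/rowP => i; rewrite !mxE permK.
Qed.

End Radius.

Section Colourings.
Context {R : comNzRingType} {T C : finType}.
Implicit Types (c : T -> C) (x : T -> R) (a b j : C) (u v w : T).

Lemma fibre_recolour c u b j : c u != b ->
  fibre [eta c with u |-> b] j =
  if j == b then (u |: fibre c b)%SET else (fibre c j :\ u)%SET.
Proof.
move=> cub; apply/setP => i; have [->|jb] := eqVneq j b; rewrite !inE /=.
  by have [->|] := eqVneq i u; rewrite ?eqxx.
by have [->|//] := eqVneq i u; rewrite eq_sym (negbTE jb).
Qed.

Lemma card_fibre_recolour_source c u b : c u != b ->
  #|fibre [eta c with u |-> b] (c u)| = #|fibre c (c u)|.-1.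
Proof.
by move=> cub; rewrite fibre_recolour// (negbTE cub) [in RHS](cardsD1 u) inE eqxx.
Qed.

Lemma card_fibre_recolour_target c u b : c u != b ->
  #|fibre [eta c with u |-> b] b| = #|fibre c b|.+1.
Proof. by move=> cub; rewrite fibre_recolour// eqxx cardsU1 inE (negbTE cub). Qed.

Lemma colour_sum_recolour c u b j x : c u != b -> j != c u -> j != b ->
  colour_sum [eta c with u |-> b] x j = colour_sum c x j.
Proof.
move=> cub jcu jb; rewrite /colour_sum fibre_recolour// (negbTE jb).
apply: eq_bigl => i; rewrite !inE; have [->|//] := eqVneq i u.
by rewrite eq_sym (negbTE jcu).
Qed.

Lemma sum_colour_sums c x a b : a != b ->
  \sum_i x i = colour_sum c x a + colour_sum c x b +
    \sum_(j | (j != a) && (j != b)) colour_sum c x j.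
Proof.
move=> ab; rewrite (partition_big c xpredT)//= (bigD1 a)//= (bigD1 b) 1?eq_sym//= addrA.
by congr (_ + _ + _); [..|apply: eq_bigr => j _]; apply: eq_bigl => i; rewrite inE.
Qed.

Lemma disjoint_fibres c a b : a != b -> [disjoint fibre c a & fibre c b].
Proof.
by move=> ab; apply/pred0P => i; rewrite /= !inE; apply: contraNF ab => /andP[/eqP ->].
Qed.

Definition relevel c a b (s t : R) x i : R :=
  if c i == a then s else if c i == b then t else x i.

Lemma colour_sum_relevel c a b (s t : R) x j :
  colour_sum c (relevel c a b s t x) j =
  if j == a then #|fibre c a|%:R * s else
  if j == b then #|fibre c b|%:R * t else colour_sum c x j.
Proof.
rewrite /colour_sum (eq_bigr (fun i => if j == a then s else if j == b then t else x i)).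
  have [->|_] := eqVneq j a; first by rewrite sumr_const mulr_natl.
  by have [->|_] := eqVneq j b; first by rewrite sumr_const mulr_natl.
by move=> i; rewrite inE /relevel => /eqP ->.
Qed.

Lemma sum_relevel c a b (s t : R) x : a != b ->
  \sum_i relevel c a b s t x i = #|fibre c a|%:R * s + #|fibre c b|%:R * t +
    \sum_(j | (j != a) && (j != b)) colour_sum c x j.
Proof.
move=> ab; rewrite (sum_colour_sums c _ ab) !colour_sum_relevel !eqxx.
rewrite [b == a]eq_sym (negbTE ab); congr (_ + _).
by apply: eq_bigr => j /andP[ja jb]; rewrite colour_sum_relevel (negbTE ja) (negbTE jb).
Qed.

Definition transfer v w (h : R) x i : R := x i + h * (i == v)%:R - h * (i == w)%:R.

Lemma colour_sum_transfer c v w (h : R) x j :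
  colour_sum c (transfer v w h x) j =
  colour_sum c x j + h * (c v == j)%:R - h * (c w == j)%:R.
Proof.
have indicator u : \sum_(i in fibre c j) h * (i == u)%:R = h * (c u == j)%:R.
  have [cu|cu] := eqVneq (c u) j.
    rewrite (bigD1 u) ?inE ?cu//= eqxx big1 ?addr0// => i /andP[_ /negbTE->].
    by rewrite mulr0.
  rewrite mulr0 big1// => i; rewrite inE => /eqP ci.
  by rewrite (negbTE (contraNneq _ cu)) ?mulr0// => <-; apply/eqP.
by rewrite /colour_sum sumrB big_split /= !indicator.
Qed.

End Colourings.

Section Multipartite.
Context {k n : nat}.
Implicit Types (r : nat) (c : 'I_n -> 'I_k).

Definition multipartite r c : uhypergraph r n := complete_kpartite r (fibre c).

Lemma mem_multipartite r c e : (e \in edges (multipartite r c)) = rainbow c r setT e.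
Proof.
rewrite inE /rainbow subsetT andbT; apply: andb_id2l => /eqP <-.
apply/forallP/imset_injP => [ce i i' ie i'e cii'|c_inj j].
  by apply: (card_le1_eqP (ce (c i))); rewrite !inE ?ie ?i'e ?cii' eqxx.
apply/card_le1_eqP => i i'; rewrite !inE => /andP[ie /eqP ci] /andP[i'e /eqP ci'].
by apply: c_inj => //; rewrite ci.
Qed.

Lemma polyform_multipartite {R : realType} r c (x : 'rV[R]_n) :
  polyform (multipartite r c) x =
  (r`!)%:R * elem_sym r setT (colour_sum c (x ord0)).
Proof.
by rewrite -rainbow_sumE; congr (_ * _); apply: eq_bigl => e; exact: mem_multipartite.
Qed.

End Multipartite.

Section MultipartiteMaximizer.
Context {R : realType} {k r n : nat} (p : R).
Hypotheses (r_gt1 : (1 < r)%N) (p_gt1 : 1 < p).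
Implicit Types (c : 'I_n -> 'I_k) (x y : 'rV[R]_n).

Let p_gt0 : 0 < p. Proof. exact: lt_trans p_gt1. Qed.
Let p_ge1 : 1 <= p. Proof. exact: ltW. Qed.
Let r_gt0 : (0 < r)%N. Proof. exact: ltnW. Qed.

Lemma power_sum_transfer_half v w x (h := x ord0 w / 2) :
  x ord0 v = 0 -> 0 < x ord0 w ->
  power_sum p (\row_i transfer v w h (x ord0) i) < power_sum p x.
Proof.
move=> xv xw; have h_gt0 : 0 < h by rewrite divr_gt0.
have wv : w != v by apply: contraTneq xw => ->; rewrite xv ltxx.
have xwE : x ord0 w = h + h by rewrite /h -splitr.
rewrite /power_sum (bigD1 v)//= (bigD1 w)//=.
rewrite [ltRHS](bigD1 v)//= [X in _ < _ + X](bigD1 w)//= !addrA.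
apply: ltr_leD; last first.
  apply: ler_sum => i /andP[/negbTE iv /negbTE iw].
  by rewrite mxE /transfer iv iw !mulr0 addr0 subr0.
rewrite !mxE /transfer !eqxx [v == w]eq_sym (negbTE wv) xv xwE !mulr1 !mulr0.
rewrite add0r subr0 addr0 addrK normr0 powR0 ?gt_eqF// add0r !gtr0_norm ?addr_gt0//.
exact: lt_double_powR.
Qed.

Lemma exists_transfer_donor c x v : (forall i, 0 <= x ord0 i) -> x != 0 ->
  exists2 w, 0 < x ord0 w & c w = c v \/ colour_sum c (x ord0) (c v) = 0.
Proof.
move=> x_ge0 x_neq0.
have [sv|sv] := eqVneq (colour_sum c (x ord0) (c v)) 0.
  by have /rV0Pn[w xw] := x_neq0; exists w; [rewrite lt0r xw x_ge0|right].
move: sv; rewrite psumr_neq0// => /hasP[w _ /andP[]]; rewrite inE => /eqP cw xw.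
by exists w => //; left.
Qed.

Lemma elem_sym_transfer_half c v w x (h := x ord0 w / 2) : (forall i, 0 <= x ord0 i) ->
  c w = c v \/ colour_sum c (x ord0) (c v) = 0 ->
  elem_sym r setT (colour_sum c (x ord0)) <=
  elem_sym r setT (colour_sum c (transfer v w h (x ord0))).
Proof.
move=> x_ge0 vw; set s := colour_sum c _; set t := colour_sum c _.
have tE j : t j = s j + h * (c v == j)%:R - h * (c w == j)%:R.
  exact: colour_sum_transfer.
have s_ge0 j : 0 <= s j by exact: sumr_ge0.
have [cvw|cvw] := eqVneq (c v) (c w).
  by rewrite (@eq_elem_sym _ _ _ _ s t)// => j _; rewrite tE cvw addrK.
have sv : s (c v) = 0 by case: vw => // E; rewrite E eqxx in cvw.
have tv : t (c v) = h by rewrite tE sv eqxx eq_sym (negbTE cvw) mulr1 mulr0 add0r subr0.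
have tw : t (c w) = s (c w) - h by rewrite tE eqxx (negbTE cvw) mulr1 mulr0 addr0.
have h_ge0 : 0 <= h by rewrite divr_ge0.
have h_le : h <= s (c w).
  apply: (@le_trans _ _ (x ord0 w)); first by rewrite ler_pdivrMr// ler_peMr// ler1n.
  by rewrite /s /colour_sum (bigD1 w) ?inE//= lerDl sumr_ge0.
apply: (elem_sym_le_transfer r_gt1 s_ge0 cvw) => [j||].
- rewrite !inE negb_or => /andP[jv jw].
  by rewrite tE eq_sym (negbTE jv) eq_sym (negbTE jw) !mulr0 addr0 subr0.
- by rewrite tv tw sv add0r addrC subrK.
- by rewrite sv mul0r tv tw mulr_ge0// subr_ge0.
Qed.

(* Otherwise giving half the weight of a suitable vertex to a vertex of weight 0
   would decrease the norm without decreasing the form. *)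
Lemma multipartite_maximizer_gt0 c x (G := multipartite r c) :
  (forall i, 0 <= x ord0 i) -> power_sum p x = 1 ->
  polyform G x = pspectral_radius p G -> 0 < pspectral_radius p G ->
  forall v, 0 < x ord0 v.
Proof.
move=> x_ge0 x_sphere xmax G_gt0 v; rewrite lt0r x_ge0 andbT; apply/negP => /eqP xv.
have x_neq0 : x != 0 by rewrite -(power_sum_eq0 _ p_gt0) x_sphere oner_eq0.
have [w xw vw] := exists_transfer_donor c v x_ge0 x_neq0.
pose y : 'rV[R]_n := \row_i transfer v w (x ord0 w / 2) (x ord0) i.
have y_lt1 : power_sum p y < 1 by rewrite -x_sphere; exact: power_sum_transfer_half.
have yE : y ord0 =1 transfer v w (x ord0 w / 2) (x ord0) by move=> i; rewrite mxE.
have Gxy : pspectral_radius p G <= polyform G y.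
  rewrite -xmax !polyform_multipartite ler_wpM2l// (funext yE).
  exact: elem_sym_transfer_half.
have := lt_radius r_gt0 p_ge1 G_gt0 Gxy (ltW y_lt1) (or_intror y_lt1).
by rewrite ltxx.
Qed.

Lemma radius_proper_multipartite c (G : uhypergraph r n) (K := multipartite r c) :
  (0 < n)%N -> edges G \proper edges K -> 0 < pspectral_radius p K ->
  pspectral_radius p G < pspectral_radius p K.
Proof.
move=> n_gt0 GK K_gt0; have GsubK := proper_sub GK.
rewrite lt_neqAle radius_subset// andbT; apply/eqP => GKE.
have [x [x_ge0 x_sphere xmax]] := nonneg_maximizer G n_gt0 p_ge1.
have Kx : polyform K x <= pspectral_radius p K.
  by rewrite (le_trans (polyform_le_radius K x r_gt0 p_ge1))// x_sphere powR1 mulr1.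
have xmaxK : polyform K x = pspectral_radius p K.
  by apply/le_anti; rewrite Kx -GKE -xmax polyform_subset.
have := polyform_proper GK (multipartite_maximizer_gt0 x_ge0 x_sphere xmaxK K_gt0).
by rewrite xmax xmaxK GKE ltxx.
Qed.

Lemma power_sum_relevel c a b (s t : R) x : a != b -> 0 <= s -> 0 <= t ->
  power_sum p (\row_i relevel c a b s t (x ord0) i) =
  #|fibre c a|%:R * s `^ p + #|fibre c b|%:R * t `^ p +
    \sum_(j | (j != a) && (j != b)) colour_sum c (fun i => `|x ord0 i| `^ p) j.
Proof.
move=> ab s_ge0 t_ge0; rewrite -sum_relevel//; apply: eq_bigr => i _.
by rewrite mxE /relevel; do 2?case: ifP => _ //; rewrite ger0_norm.
Qed.

Lemma rebalance_colouring c a b x (s := colour_sum c (x ord0)) :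
  (forall i, 0 < x ord0 i) -> (#|fibre c b|.+1 < #|fibre c a|)%N ->
  exists c' y, let t := colour_sum c' (y ord0) in
  [/\ {in (~: [set a; b])%SET, s =1 t}, s a + s b = t a + t b, s a * s b <= t a * t b,
      power_sum p y <= power_sum p x &
      s a * s b < t a * t b \/ power_sum p y < power_sum p x].
Proof.
move=> x_gt0 class_gap; have /card_gt0P[u] : (0 < #|fibre c a|)%N by lia.
rewrite inE => /eqP cu.
have ab : a != b by apply: contraTneq class_gap => ->; rewrite -leqNgt.
have [v [w [[v_ge0 w_ge0] sum_eq prod_le norm_le strict]]] :=
  rebalance_blocks p_gt1 x_gt0 (disjoint_fibres c ab) class_gap.
have cub : c u != b by rewrite cu.
pose c' := [eta c with u |-> b].
have cardA : #|fibre c' a| = #|fibre c a|.-1 by rewrite -cu card_fibre_recolour_source.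
have cardB := card_fibre_recolour_target cub : #|fibre c' b| = #|fibre c b|.+1.
have same F j : j != a -> j != b -> colour_sum c' F j = colour_sum c F j.
  by move=> ja jb; rewrite colour_sum_recolour// cu.
pose y : 'rV[R]_n := \row_i relevel c' a b v w (x ord0) i.
have yE : y ord0 = relevel c' a b v w (x ord0) by apply/funext => i; rewrite mxE.
have tE := colour_sum_relevel c' a b v w (x ord0).
have ta := tE a; rewrite eqxx cardA in ta.
have tb := tE b; rewrite [b == a]eq_sym (negbTE ab) eqxx cardB in tb.
pose rest := \sum_(j | (j != a) && (j != b)) colour_sum c (fun i => `|x ord0 i| `^ p) j.
have normx : power_sum p x =
    \sum_(i in fibre c a) x ord0 i `^ p + \sum_(i in fibre c b) x ord0 i `^ p + rest.
  rewrite /power_sum (sum_colour_sums c _ ab); congr (_ + _ + _);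
    by apply: eq_bigr => i _; rewrite gtr0_norm.
have normy : power_sum p y =
    #|fibre c a|.-1%:R * v `^ p + #|fibre c b|.+1%:R * w `^ p + rest.
  rewrite power_sum_relevel// cardA cardB; congr (_ + _).
  by apply: eq_bigr => j /andP[ja jb]; exact: same.
exists c', y; rewrite /= yE ta tb normx normy lerD2r ltrD2r; split=> // j.
by rewrite !inE negb_or => /andP[ja jb]; rewrite tE (negbTE ja) (negbTE jb) same.
Qed.

Lemma lt_radius_unbalanced c a b : 0 < pspectral_radius p (multipartite r c) ->
  (#|fibre c b|.+1 < #|fibre c a|)%N ->
  exists c',
    pspectral_radius p (multipartite r c) < pspectral_radius p (multipartite r c').
Proof.
move=> K_gt0 class_gap; have /card_gt0P[u _] : (0 < #|fibre c a|)%N by lia.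
have n_gt0 := leq_ltn_trans (leq0n u) (ltn_ord u).
have ab : a != b by apply: contraTneq class_gap => ->; rewrite -leqNgt.
have [x [x_ge0 x_sphere xmax]] := nonneg_maximizer (multipartite r c) n_gt0 p_ge1.
have x_gt0 := multipartite_maximizer_gt0 x_ge0 x_sphere xmax K_gt0.
have [c' [y [st sum_eq prod_le]]] := rebalance_colouring x_gt0 class_gap.
rewrite x_sphere => norm_le strict; exists c'.
have s_ge0 j : 0 <= colour_sum c (x ord0) j by exact: sumr_ge0.
have r_fact : 0 < r`!%:R :> R by rewrite ltr0n fact_gt0.
apply: (lt_radius (y := y)) => //; rewrite -xmax !polyform_multipartite.
  by rewrite ler_pM2l//; exact: (elem_sym_le_transfer r_gt1 s_ge0 ab).
rewrite ltr_pM2l//; case: strict => [prod_lt|]; [left|by right].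
apply: (elem_sym_lt_transfer r_gt1 s_ge0 ab) => //.
by rewrite -(pmulr_rgt0 _ r_fact) -polyform_multipartite xmax.
Qed.

End MultipartiteMaximizer.

Lemma eq_fibres_perm {T U : finType} (f g : T -> U) :
  (forall y, #|fibre f y| = #|fibre g y|) -> exists s : {perm T}, forall i, f i = g (s i).
Proof.
move=> fg.
have count_codom h y : count_mem y (codom h) = #|fibre h y|.
  rewrite count_map -sum1_count -sum1_card big_enum_cond /=.
  by apply: eq_bigl => i; rewrite inE.
have /tuple_permP[s codomE] : perm_eq (codom_tuple f) (codom_tuple g).
  by apply/allP => y _; rewrite /= !count_codom fg.
pose t i := enum_val (s (enum_rank i)).
have t_inj : injective t by move=> i j /enum_val_inj/perm_inj/enum_rank_inj.
exists (perm t_inj) => i; rewrite permE /t.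
have /val_inj/(congr1 (fun v => tnth v (enum_rank i))) := codomE.
by rewrite tnth_mktuple !(tnth_nth (f i)) /= !nth_codom enum_rankK.
Qed.

Section Balanced.
Context {T C : finType}.
Implicit Types (c d : T -> C) (a b j : C).

Definition balanced c : bool :=
  [forall a, forall b, (#|fibre c a| <= #|fibre c b|.+1)%N].

Lemma balancedP c : reflect (forall a b, #|fibre c a| <= #|fibre c b|.+1)%N (balanced c).
Proof. exact: 'forall_forallP. Qed.

Lemma sum_card_fibre c : (\sum_j #|fibre c j|)%N = #|T|.
Proof.
rewrite -sum1_card (partition_big c xpredT)//=; apply: eq_bigr => j _.
by rewrite -sum1_card; apply: eq_bigl => i; rewrite inE.
Qed.

Lemma card_balanced_fibre c j : balanced c ->
  #|fibre c j| = (#|T| %/ #|C| + (#|fibre c j| == (#|T| %/ #|C|).+1))%N.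
Proof.
move=> /balancedP bal.
have [j0 _ minj] := @arg_minnP _ j xpredT (fun j => #|fibre c j|) isT.
set q := #|fibre c j0| in minj.
have sizeE i : #|fibre c i| = (q + (#|fibre c i| != q))%N.
  by have := minj i isT; have := bal i j0; rewrite -/q; case: eqP; lia.
have C_gt0 : (0 < #|C|)%N by apply/card_gt0P; exists j.
suff -> : (#|T| %/ #|C|)%N = q by have := sizeE j; do 2!case: eqP; lia.
rewrite -(sum_card_fibre c) (eq_bigr _ (fun i _ => sizeE i)) big_split /=.
rewrite sum_nat_const mulnC divnMDl// divn_small ?addn0// (bigD1 j0)//= eqxx add0n.
apply: (@leq_ltn_trans (\sum_(i | i != j0) 1)%N).
  by apply: leq_sum => i _; case: (_ != _).
by rewrite sum1_card cardC1 prednK.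
Qed.

Lemma card_large_fibres c : balanced c ->
  #|[set j | #|fibre c j| == (#|T| %/ #|C|).+1]%SET| = (#|T| %% #|C|)%N.
Proof.
move=> bal; have := sum_card_fibre c.
rewrite (eq_bigr _ (fun j _ => card_balanced_fibre j bal)) big_split /= sum_nat_const.
rewrite [in RHS](divn_eq #|T| #|C|) mulnC => /addnI <-.
by rewrite -sum1_card big_mkcond; apply: eq_bigr => j _; rewrite inE; case: eqP.
Qed.

Lemma balanced_perm c d : balanced c -> balanced d ->
  exists (s : {perm C}) (t : {perm T}), forall i, s (c i) = d (t i).
Proof.
move=> bal_c bal_d; pose large (f : T -> C) j := #|fibre f j| == (#|T| %/ #|C|).+1.
have large_true f : balanced f -> #|fibre (large f) true| = (#|T| %% #|C|)%N.
  move=> bal_f; rewrite -(card_large_fibres bal_f).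
  by apply: eq_card => j; rewrite !inE eqb_id.
have large_false f : fibre (large f) false = (~: fibre (large f) true)%SET.
  by apply/setP => j; rewrite !inE eqb_id eqbF_neg.
have [s sE] : exists s : {perm C}, forall j, large c j = large d (s j).
  apply: eq_fibres_perm => -[]; first by rewrite !large_true.
  by apply: (@addnI #|fibre (large c) true|);
    rewrite !large_false cardsC [in RHS](large_true c)// -(large_true d)// cardsC.
have card_s j : #|fibre c j| = #|fibre d (s j)|.
  rewrite (card_balanced_fibre j bal_c) -/(large c j) sE.
  by rewrite [RHS](card_balanced_fibre (s j) bal_d).
exists s; apply: (@eq_fibres_perm _ _ (s \o c) d) => j.
rewrite -[in RHS](permKV s j) -card_s; apply: eq_card => i; rewrite !inE /=.
by rewrite -[RHS](inj_eq (@perm_inj _ s)) permKV.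
Qed.

End Balanced.

Section BalancedMultipartite.
Context {R : realType} {k r n : nat} (p : R).
Implicit Types (c d : 'I_n -> 'I_k).

Lemma multipartite_iso c d (s : {perm 'I_k}) (t : {perm 'I_n}) :
  (forall i, s (c i) = d (t i)) -> uhypergraph_iso (multipartite r c) (multipartite r d).
Proof.
move=> st; exists t; apply/setP => e.
rewrite (can_imset_pre (g := fun e' : {set 'I_n} => (t^-1)%g @: e')%SET); last first.
  by move=> e'; rewrite -imset_comp -[RHS]imset_id; apply: eq_imset => i /=; exact: permK.
rewrite [RHS]inE !mem_multipartite /rainbow !subsetT.
have -> : (d @: e = s @: (c @: ((t^-1)%g @: e)))%SET.
  by rewrite -!imset_comp; apply: eq_imset => i /=; rewrite st permKV.
by rewrite !(card_imset _ (@perm_inj _ _)).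
Qed.

Lemma balanced_iso c d : balanced c -> balanced d ->
  uhypergraph_iso (multipartite r c) (multipartite r d).
Proof.
move=> bal_c bal_d; have [s [t st]] := balanced_perm bal_c bal_d.
exact: multipartite_iso st.
Qed.

Lemma leif_radius_multipartite c d : (1 < r)%N -> 1 < p -> balanced d ->
  0 < pspectral_radius p (multipartite r d) ->
  pspectral_radius p (multipartite r c) <= pspectral_radius p (multipartite r d)
    ?= iff balanced c.
Proof.
move=> r_gt1 p_gt1 bal_d d_gt0.
pose radius (f : {ffun 'I_n -> 'I_k}) := pspectral_radius p (multipartite r f).
have radiusE c' : pspectral_radius p (multipartite r c') = radius (finfun c').
  by congr (pspectral_radius p (multipartite r _)); apply/funext => i; rewrite ffunE.
have [f _ fmax] := @arg_maxP _ _ _ (finfun d) xpredT radius isT.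
have radius_le c' : pspectral_radius p (multipartite r c') <= radius f.
  by rewrite radiusE; exact: fmax.
have maximal_balanced c' :
    radius f <= pspectral_radius p (multipartite r c') -> balanced c'.
  move=> c'_max; apply/balancedP => a b; rewrite leqNgt; apply/negP => ab.
  have c'_gt0 := lt_le_trans d_gt0 (le_trans (radius_le d) c'_max).
  have [c'' c'_lt] := lt_radius_unbalanced r_gt1 p_gt1 c'_gt0 ab.
  by have := lt_le_trans c'_lt (radius_le c''); rewrite ltNge c'_max.
have balanced_radius c' :
    balanced c' -> pspectral_radius p (multipartite r c') = radius f.
  by move=> bal_c'; apply/radius_iso/balanced_iso => //; exact: maximal_balanced.
rewrite (balanced_radius d)//; apply/leifP; case: ifPn => [/balanced_radius ->//|].
by rewrite ltNge; apply: contra => /maximal_balanced.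
Qed.

Lemma edges_order_lt (G : uhypergraph r n) : (n < r)%N -> edges G = set0.
Proof.
move=> nr; apply/setP => e; rewrite inE; apply/negP => /edges_uniform er.
by have := max_card (mem e); rewrite card_ord er leqNgt nr.
Qed.

Lemma kpartition_fibre (V : 'I_k -> {set 'I_n}) : kpartition V -> exists c, V = fibre c.
Proof.
move=> /choice[c cV]; exists c; apply/funext => j; apply/setP => i; rewrite inE.
by have [ici uniq_ci] := cV i; apply/idP/eqP => [/uniq_ci|<-].
Qed.

Lemma kpartite_multipartite (G : uhypergraph r n) : kpartite k G ->
  exists c, edges G \subset edges (multipartite r c).
Proof.
case=> V [/kpartition_fibre[c ->{V}] G_crosses]; exists c; apply/subsetP => e eG.
by rewrite inE (edges_uniform eG) eqxx G_crosses.
Qed.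

Lemma turan_multipartite : (0 < k)%N ->
  exists2 d : 'I_n -> 'I_k, balanced d & turan k r n = multipartite r d.
Proof.
move=> k_gt0; have [d dE] := kpartition_fibre (@kpartition_turan k n k_gt0).
exists d; last by rewrite /turan dE.
apply/balancedP => a b; rewrite -dE.
have floor_le : (n %/ k <= (n + k.-1) %/ k)%N by apply: leq_div2r; lia.
have ceil_le : ((n + k.-1) %/ k <= (n %/ k).+1)%N.
  have -> : (n %/ k).+1 = ((n + k) %/ k)%N by rewrite divnDr// divnn k_gt0 addn1.
  by apply: leq_div2r; lia.
by case: (card_turan_part n a) (card_turan_part n b) => -> [] ->; lia.
Qed.

Lemma turan_edges_neq0 : (r <= k)%N -> (r <= n)%N -> edges (turan k r n) != set0.
Proof.
move=> rk rn; apply/set0Pn; exists [set widen_ord rn i | i : 'I_r]%SET.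
rewrite inE card_imset ?card_ord ?eqxx /= => [|i j /(congr1 val)/=]; last exact: val_inj.
apply/forallP => j; apply/card_le1_eqP => i i'.
rewrite !inE => /andP[/imsetP[l _ ->] /eqP lj] /andP[/imsetP[l' _ ->] /eqP l'j].
apply/val_inj => /=; move: lj l'j => /=.
by rewrite !modn_small ?(leq_trans (ltn_ord _) rk)// => -> ->.
Qed.

End BalancedMultipartite.

Theorem theorem2 (R : realType) (k r n : nat) (G : uhypergraph r n) (p : R) :
  (2 <= r)%N -> (r <= k)%N -> kpartite k G -> 1 < p ->
  ~ uhypergraph_iso G (turan k r n) ->
  pspectral_radius p G < pspectral_radius p (turan k r n).
Proof.
move=> r_ge2 rk /kpartite_multipartite[c GK] p_gt1 G_not_turan.
have [r_gt0 p_ge1] := (ltnW r_ge2, ltW p_gt1).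
have [rn|nr] := leqP r n; last first.
  by case: G_not_turan; exists 1%g; rewrite !edges_order_lt// imset0.
have turan_gt0 : 0 < pspectral_radius p (turan k r n).
  by apply: radius_gt0_edges => //; exact: turan_edges_neq0.
have [d bal_d turanE] := @turan_multipartite k r n (leq_trans r_gt0 rk).
rewrite turanE in G_not_turan turan_gt0 *.
have n_gt0 : (0 < n)%N by exact: leq_trans rn.
have G_le := radius_subset n_gt0 p_ge1 GK.
have K_leif := leif_radius_multipartite c r_ge2 p_gt1 bal_d turan_gt0.
have [bal_c|unbal_c] := boolP (balanced c); last first.
  by apply: le_lt_trans G_le _; rewrite (lt_leif K_leif).
have K_eq := eqTleif K_leif bal_c; rewrite -K_eq in turan_gt0 *.
apply: radius_proper_multipartite => //; rewrite properEneq GK andbT.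
apply/eqP => GE; have [s sE] := balanced_iso (r := r) bal_c bal_d.
by apply: G_not_turan; exists s; rewrite GE.
Qed.
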